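(* Let $X$ and $Y$ be metric spaces, and let $C\subseteq X$ and $D\subseteq Y$ be non-empty subsets. If $f\colon X\to Y$ is a quasi-isometry such that the Hausdorff distance $\mathsf{hdist}(f(C),D)$ is finite, then the induced map $\mathsf{E}(f)\colon\mathsf{E}(X,C)\to\mathsf{E}(Y,D)$ on sets of filtered ends is a bijection.
   Context: For a subset $C$ of a metric space and $\mu\ge 0$, $C^{+\mu}$ is the open $\mu$-neighborhood of $C$. A subset $A$ is $\sigma$-coarsely connected if any two points of $A$ are joined by a finite sequence of points of $A$ with consecutive distances $\le\sigma$. For a metric space $Z$, $\mathcal{C}_\infty(Z,\sigma)$ is the set of unbounded $\sigma$-coarsely connected components of $Z$. Filtered ends. Let $X$ be a metric space and $C\subseteq X$. For $\sigma\geq 0$ and $\mu\le\mu'$ there is a map $\mathcal{C}_\infty(X-C^{+\mu'},\sigma)\to\mathcal{C}_\infty(X-C^{+\mu},\sigma)$ sending a component to the component containing it; $\mathsf{E}(X,C,\sigma)=\varprojlim_{\mu}\mathcal{C}_\infty(X-C^{+\mu},\sigma)$. For $\sigma\le\sigma'$ the maps sending a $\sigma$-component of $X-C^{+\mu}$ to the $\sigma'$-component containing it induce $\varphi_{\sigma,\sigma'}\colon\mathsf{E}(X,C,\sigma)\to\mathsf{E}(X,C,\sigma')$, and $\mathsf{E}(X,C)=\varinjlim_\sigma\mathsf{E}(X,C,\sigma)$. Quasi-isometries. A map $f\colon X\to Y$ is a quasi-isometry if there are $\lambda\ge1$, $\epsilon\ge0$ and a map $\bar f\colon Y\to X$ such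 that $f$ and $\bar f$ are $(\lambda,\epsilon)$-coarse Lipschitz (i.e. $\mathsf{dist}(f(x),f(x'))\le\lambda\,\mathsf{dist}(x,x')+\epsilon$, similarly for $\bar f$) and $\bar f\circ f$, $f\circ\bar f$ are at distance at most $\epsilon$ from the identity maps. Induced map. Suppose $f\colon X\to Y$ satisfies $\frac1\lambda\mathsf{dist}(x,x')-\epsilon\le\mathsf{dist}(f(x),f(x'))\le\lambda\,\mathsf{dist}(x,x')+\epsilon$ for all $x,x'\in X$ (such constants $\lambda\geq 1,\epsilon\geq 0$ exist for a quasi-isometry) and $D\subseteq f(C)^{+r}$ for some $r\ge0$. For $\sigma>0$ and $\mu\ge\lambda(\epsilon+r)$, sending $A$ to the unique component containing $f(A)$ defines a map $\mathcal{C}_\infty(X-C^{+\mu},\sigma)\to\mathcal{C}_\infty(Y-D^{+(\mu/\lambda-\epsilon-r)},\lambda\sigma+\epsilon)$. Taking inverse limits over $\mu$ gives $\mathsf{E}(X,C,\sigma)\to\mathsf{E}(Y,D,\lambda\sigma+\epsilon)$, and taking direct limits over $\sigma$ gives $\mathsf{E}(f)\colon\mathsf{E}(X,C)\to\mathsf{E}(Y,D)$ (independent of the choices of constants). *)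

(* Defs.v *)
From HB Require Import structures.
From mathcomp Require Import all_boot all_order all_algebra.
From mathcomp Require Import all_classical all_reals.
From mathcomp Require Import ereal topology.
From mathcomp Require Import lra.

Set Implicit Arguments.
Unset Strict Implicit.
Unset Printing Implicit Defensive.

Import Order.TTheory GRing.Theory Num.Theory.

Local Open Scope classical_set_scope.
Local Open Scope ring_scope.

Section inverse_limit.
Variables (I : Type) (le : I -> I -> Prop) (F : I -> Type).
Variable t : forall i j, le i j -> F j -> F i.

Definition invlim :=
  {e : forall i, F i | forall i j (ij : le i j), t ij (e j) = e i}.

Definition Invlim (e : forall i, F i)
    (he : forall i j (ij : le i j), t ij (e j) = e i) : invlim :=
  exist _ e he.

Lemma invlim_inj (e e' : invlim) : (forall i, sval e i = sval e' i) -> e = e'.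
Proof.
case: e e' => [e he] [e' he'] /= ee'; apply: eq_exist.
exact: functional_extensionality_dep.
Qed.

End inverse_limit.

(* The direct limit is the quotient of the disjoint union by eventual equality,
   its points being the classes. The lemmas assume that the system is
   functorial and directed, as needed for [dirlim_rel] to be an equivalence. *)
Section direct_limit.
Variables (I : Type) (le : I -> I -> Prop) (F : I -> Type).
Variable t : forall i j, le i j -> F i -> F j.

Definition dirlim_rel (x y : {i & F i}) : Prop :=
  exists k (xk : le (tag x) k) (yk : le (tag y) k),
    t xk (tagged x) = t yk (tagged y).

Definition dirlim := {P : set {i & F i} | exists x, P = dirlim_rel x}.

Definition dirlim_class (x : {i & F i}) : dirlim :=
  exist _ (dirlim_rel x) (ex_intro _ x erefl).

Definition dirlim_repr (P : dirlim) : {i & F i} := sval (cid (svalP P)).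

Lemma dirlim_reprK (P : dirlim) : dirlim_class (dirlim_repr P) = P.
Proof.
by case: P => P hP; apply: eq_exist; rewrite /dirlim_repr; case: cid => x /= ->.
Qed.

Hypothesis le_refl : forall i, le i i.
Hypothesis le_trans : forall i j k, le i j -> le j k -> le i k.
Hypothesis le_dir : forall i j, exists2 k, le i k & le j k.
Hypothesis t_comp : forall i j k (ij : le i j) (jk : le j k) (ik : le i k) x,
  t jk (t ij x) = t ik x.

Lemma dirlim_rel_refl x : dirlim_rel x x.
Proof. by exists (tag x), (le_refl _), (le_refl _). Qed.

Lemma dirlim_rel_sym x y : dirlim_rel x y -> dirlim_rel y x.
Proof. by move=> [k [xk [yk h]]]; exists k, yk, xk. Qed.

Lemma dirlim_rel_trans x y z :
  dirlim_rel x y -> dirlim_rel y z -> dirlim_rel x z.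
Proof.
move=> [k [xk [yk h]]] [l [yl [zl h']]].
have [m km lm] := le_dir k l.
exists m, (le_trans xk km), (le_trans zl lm).
rewrite -(t_comp xk km) h -(t_comp zl lm) -h'.
by rewrite (t_comp yk km (le_trans yl lm)) (t_comp yl lm (le_trans yl lm)).
Qed.

Lemma dirlim_classP x y : dirlim_class x = dirlim_class y <-> dirlim_rel x y.
Proof.
split=> [/(congr1 sval) /= ->|xy]; first exact: dirlim_rel_refl.
apply: eq_exist; apply/seteqP; split=> z; apply: dirlim_rel_trans => //.
exact: dirlim_rel_sym.
Qed.

End direct_limit.

Section dirlim_map.
Variables (I : Type) (leI : I -> I -> Prop) (F : I -> Type).
Variable t : forall i j, leI i j -> F i -> F j.
Variables (J : Type) (leJ : J -> J -> Prop) (G : J -> Type).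
Variable u : forall i j, leJ i j -> G i -> G j.

(* Only meaningful when [h] respects [dirlim_rel]; see [filtered_ends_map_ofE]. *)
Definition dirlim_map (h : {i & F i} -> {j & G j}) (P : dirlim t) : dirlim u :=
  dirlim_class u (h (dirlim_repr P)).

End dirlim_map.

Section coarse_geometry.
Context {R : realType} {X : metricType R}.
Implicit Types (A B C Z : set X) (s m : R).

Definition open_nbhd_of C m : set X := [set x | exists2 c, C c & mdist x c < m].

Definition hdist A B : \bar R :=
  ereal_inf [set r%:E | r in
    [set r | [/\ 0 <= r, A `<=` open_nbhd_of B r & B `<=` open_nbhd_of A r]]].

Definition chain_in s A x y : Prop :=
  exists p : seq X, [/\ path (fun a b => mdist a b <= s) x p, last x p = y
                      & forall z, z \in x :: p -> A z].

Definition coarsely_connected s A : Prop :=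
  forall x y, A x -> A y -> chain_in s A x y.

Definition coarse_component s Z B : Prop :=
  [/\ B !=set0, B `<=` Z, coarsely_connected s B
    & forall B', B `<=` B' -> B' `<=` Z -> coarsely_connected s B' ->
      B' `<=` B].

Definition metric_bounded A : Prop :=
  exists M : R, forall x y, A x -> A y -> mdist x y <= M.

(* [Z] is a subset of the ambient space [X] and carries the induced metric. *)
Definition Cinf Z s : Type :=
  {B : set X | coarse_component s Z B /\ ~ metric_bounded B}.

Lemma chain_in_refl s Z x : Z x -> chain_in s Z x x.
Proof. by move=> Zx; exists [::]; split=> // z; rewrite inE => /eqP ->. Qed.

Lemma chain_inr s Z x y : chain_in s Z x y -> Z y.
Proof. by move=> [p [_ <- h]]; apply: h; rewrite mem_last. Qed.

Lemma chain_in_trans s Z x y z :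
  chain_in s Z x y -> chain_in s Z y z -> chain_in s Z x z.
Proof.
move=> [p [pp lp hp]] [q [pq lq hq]]; exists (p ++ q).
rewrite cat_path last_cat lp pp pq lq; split=> // w.
rewrite -cat_cons mem_cat => /orP[/hp //|wq]; apply: hq.
by rewrite inE wq orbT.
Qed.

Lemma chain_in_sym s Z x y : chain_in s Z x y -> chain_in s Z y x.
Proof.
move=> [p [pp lp hp]]; exists (rev (belast x p)); split.
- by rewrite -lp rev_path; apply: sub_path pp => a b /=; rewrite metric_sym.
- case: p lp {pp hp} => [/= ->//|a p lp].
  by rewrite /= rev_cons last_rcons.
- move=> z hz; apply: hp; rewrite lastI mem_rcons lp.
  by move: hz; rewrite !inE mem_rev.
Qed.

Lemma chain_in_mono s Z Z' x y :
  Z `<=` Z' -> chain_in s Z x y -> chain_in s Z' x y.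
Proof. by move=> ZZ' [p [pp lp hp]]; exists p; split=> // z /hp /ZZ'. Qed.

Lemma chain_in_class s Z x y :
  chain_in s Z x y -> chain_in s [set z | chain_in s Z x z] x y.
Proof.
move=> [p [pp lp hp]]; exists p; split=> // z zp /=.
case/splitPl: zp pp hp {lp} => p1 p2 lz; rewrite cat_path => /andP[pp1 _] hp.
exists p1; split=> // w wp; apply: hp.
by rewrite -cat_cons mem_cat wp.
Qed.

Lemma coarse_component_class s Z x :
  Z x -> coarse_component s Z [set y | chain_in s Z x y].
Proof.
move=> Zx; split.
- by exists x; exact: chain_in_refl.
- by move=> y /chain_inr.
- move=> y z /= /chain_in_class xy /chain_in_class xz.
  exact: chain_in_trans (chain_in_sym xy) xz.
- move=> B' hB' B'Z cB' y B'y; have B'x := hB' x (chain_in_refl s Zx).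
  exact: chain_in_mono B'Z (cB' _ _ B'x B'y).
Qed.

Lemma coarse_componentE s Z B x :
  coarse_component s Z B -> B x -> B = [set y | chain_in s Z x y].
Proof.
move=> [_ BZ cB maxB] Bx; have Zx := BZ _ Bx.
have sub : B `<=` [set y | chain_in s Z x y].
  by move=> y By; exact: chain_in_mono BZ (cB _ _ Bx By).
apply/seteqP; split=> //.
by have [_ h1 h2 _] := coarse_component_class s Zx; exact: maxB.
Qed.

Lemma metric_boundedS A B : A `<=` B -> metric_bounded B -> metric_bounded A.
Proof. by move=> AB [M hM]; exists M => x y /AB Bx /AB By; exact: hM. Qed.

Lemma Cinf_inj Z s (B B' : Cinf Z s) x : sval B x -> sval B' x -> B = B'.
Proof.
case: B B' => [B hB] [B' hB'] /= Bx B'x; apply: eq_exist.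
by rewrite (coarse_componentE hB.1 Bx) (coarse_componentE hB'.1 B'x).
Qed.

End coarse_geometry.

Section component_map.
Context {R : realType} {X Y : metricType R}.
Implicit Types (f : X -> Y) (Z : set X) (W : set Y) (s t : R).

(* Under these conditions [f] sends each unbounded s-component of [Z] into an
   unbounded t-component of [W]. *)
Definition coarse_map f Z s W t : Prop :=
  [/\ forall x, Z x -> W (f x),
      forall x x', mdist x x' <= s -> mdist (f x) (f x') <= t
    & forall A, metric_bounded (f @` A) -> metric_bounded A].

Lemma Cinf_map_subproof f Z s W t (h : coarse_map f Z s W t) (A : Cinf Z s) :
  exists B : Cinf W t, f @` sval A `<=` sval B.
Proof.
case: A => A [[[a Aa] AZ cA maxA] nA] /=; case: h => hW hd hb.
pose B := [set y | chain_in t W (f a) y].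
have AB : f @` A `<=` B.
  move=> _ [x Ax <-]; have [p [pp lp hp]] := cA _ _ Aa Ax.
  exists (map f p); split; last 2 first.
  - by rewrite last_map lp.
  - by rewrite -map_cons => z /mapP[w wp ->]; exact/hW/AZ/hp.
  by rewrite path_map; apply: sub_path pp => u v; exact: hd.
have hB : coarse_component t W B /\ ~ metric_bounded B.
  split; first exact/coarse_component_class/hW/AZ.
  by move=> /(metric_boundedS AB) /hb.
by exists (exist _ B hB).
Qed.

Definition Cinf_map f Z s W t (h : coarse_map f Z s W t) (A : Cinf Z s) :
  Cinf W t := sval (cid (Cinf_map_subproof h A)).

Lemma Cinf_map_sub f Z s W t (h : coarse_map f Z s W t) (A : Cinf Z s) :
  f @` sval A `<=` sval (Cinf_map h A).
Proof. exact: svalP (cid (Cinf_map_subproof h A)). Qed.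

Lemma Cinf_map_unique f Z s W t (h : coarse_map f Z s W t) (A : Cinf Z s)
  (B : Cinf W t) : f @` sval A `<=` sval B -> Cinf_map h A = B.
Proof.
have [[[a Aa] _ _ _] _] := svalP A.
move=> AB; apply: (@Cinf_inj _ _ _ _ _ _ (f a)).
  by apply: (Cinf_map_sub h); exists a.
by apply: AB; exists a.
Qed.

End component_map.

Lemma Cinf_map_comp {R : realType} {X Y T : metricType R} (f : X -> Y)
  (g : Y -> T) Z s W t V u (hf : coarse_map f Z s W t)
  (hg : coarse_map g W t V u) (hgf : coarse_map (g \o f) Z s V u) A :
  Cinf_map hg (Cinf_map hf A) = Cinf_map hgf A.
Proof.
apply/esym/Cinf_map_unique => _ [x Ax <-].
by apply: Cinf_map_sub; exists (f x) => //; apply: Cinf_map_sub; exists x.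
Qed.

Definition nng_le {R : realType} (a b : {nonneg R}) : Prop :=
  a%:num <= b%:num.

Section ends_at.
Context {R : realType} {X : metricType R}.
Implicit Types C : set X.

Lemma coarse_map_thicken C s (m m' : {nonneg R}) : nng_le m m' ->
  coarse_map idfun (~` open_nbhd_of C m'%:num) s (~` open_nbhd_of C m%:num) s.
Proof.
move=> mm'; split=> //; last by move=> A; rewrite image_id.
by move=> x nx [c Cc xc]; apply: nx; exists c => //; exact: lt_le_trans mm'.
Qed.

Definition ends_at C (s : R) : Type :=
  invlim (F := fun m : {nonneg R} => Cinf (~` open_nbhd_of C m%:num) s)
    (fun m m' (mm' : nng_le m m') => Cinf_map (coarse_map_thicken C s mm')).

Lemma ends_at_sub C s (e : ends_at C s) m m' :
  nng_le m m' -> sval (sval e m') `<=` sval (sval e m).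
Proof.
move=> mm' x ex; rewrite -(svalP e _ _ mm').
by apply: Cinf_map_sub; exists x.
Qed.

End ends_at.

Section ends_at_map.
Context {R : realType} {X Y : metricType R}.
Variables (f : X -> Y) (C : set X) (D : set Y) (s t : R).
Variable k : {nonneg R} -> {nonneg R}.
Hypothesis k_mono : forall n n', nng_le n n' -> nng_le (k n) (k n').
Hypothesis fk : forall n : {nonneg R},
  coarse_map f (~` open_nbhd_of C (k n)%:num) s (~` open_nbhd_of D n%:num) t.

Lemma ends_at_map_subproof (e : ends_at C s) n n' (nn' : nng_le n n') :
  Cinf_map (coarse_map_thicken D t nn')
    (Cinf_map (fk n') (sval e (k n'))) = Cinf_map (fk n) (sval e (k n)).
Proof.
have [[[a ea] _ _ _] _] := svalP (sval e (k n')).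
apply: (@Cinf_inj _ _ _ _ _ _ (f a)).
  by apply: Cinf_map_sub; exists (f a) => //; apply: Cinf_map_sub; exists a.
by apply: Cinf_map_sub; exists a => //; apply: ends_at_sub (k_mono nn') _ ea.
Qed.

Definition ends_at_map (e : ends_at C s) : ends_at D t :=
  Invlim (e := fun n => Cinf_map (fk n) (sval e (k n)))
    (fun n n' nn' => ends_at_map_subproof e nn').

End ends_at_map.

Lemma ends_at_eq {R : realType} {X : metricType R} (C : set X) s
    (e e' : ends_at C s) :
  (forall n, exists x, sval (sval e n) x /\ sval (sval e' n) x) -> e = e'.
Proof.
move=> h; apply: invlim_inj => n; have [x [ex e'x]] := h n.
exact: Cinf_inj ex e'x.
Qed.

Section filtered_ends.
Context {R : realType} {X : metricType R}.
Implicit Types C : set X.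

Lemma coarse_map_coarsen (Z : set X) (s s' : {nonneg R}) : nng_le s s' ->
  coarse_map idfun Z s%:num Z s'%:num.
Proof.
move=> ss'; split=> //; last by move=> A; rewrite image_id.
by move=> x x' /= h; exact: le_trans ss'.
Qed.

Definition ends_coarsen C (s s' : {nonneg R}) (ss' : nng_le s s') :
    ends_at C s%:num -> ends_at C s'%:num :=
  ends_at_map (k := idfun) (fun _ _ => id)
    (fun m => coarse_map_coarsen (~` open_nbhd_of C m%:num) ss').

Definition filtered_ends C : Type :=
  dirlim (F := fun s : {nonneg R} => ends_at C s%:num) (@ends_coarsen C).

Lemma nng_le_refl (s : {nonneg R}) : nng_le s s.
Proof. exact: lexx. Qed.

Lemma nng_le_trans (a b c : {nonneg R}) :
  nng_le a b -> nng_le b c -> nng_le a c.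
Proof. exact: le_trans. Qed.

Lemma nng_le_dir (a b : {nonneg R}) : exists2 c, nng_le a c & nng_le b c.
Proof.
by case: (lerP a%:num b%:num) => ab; [exists b|exists a] => //;
  rewrite /nng_le // ltW.
Qed.

Lemma ends_coarsen_sub C (s s' : {nonneg R}) (ss' : nng_le s s')
    (e : ends_at C s%:num) m :
  sval (sval e m) `<=` sval (sval (ends_coarsen ss' e) m).
Proof. by move=> x ex; apply: Cinf_map_sub; exists x. Qed.

Lemma ends_coarsen_comp C (a b c : {nonneg R}) (ab : nng_le a b)
    (bc : nng_le b c) (ac : nng_le a c) (e : ends_at C a%:num) :
  ends_coarsen bc (ends_coarsen ab e) = ends_coarsen ac e.
Proof.
apply: ends_at_eq => n; have [[[x ex] _ _ _] _] := svalP (sval e n).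
by exists x; split; do !apply: ends_coarsen_sub.
Qed.

Lemma filtered_ends_classP C (x y : {s : {nonneg R} & ends_at C s%:num}) :
  dirlim_class (@ends_coarsen C) x = dirlim_class (@ends_coarsen C) y <->
  dirlim_rel (@ends_coarsen C) x y.
Proof.
apply: dirlim_classP.
- exact: nng_le_refl.
- exact: nng_le_trans.
- exact: nng_le_dir.
- exact: ends_coarsen_comp.
Qed.

End filtered_ends.

Section induced_map.
Context {R : realType} {X Y : metricType R}.
Implicit Types (f : X -> Y) (C : set X) (D : set Y) (l e r : R).

Definition coarse_lipschitz {U V : metricType R} l e (g : U -> V) : Prop :=
  forall x x', mdist (g x) (g x') <= l * mdist x x' + e.

Definition quasi_isometry f : Prop :=
  exists l e (g : Y -> X),
    [/\ 1 <= l /\ 0 <= e, coarse_lipschitz l e f, coarse_lipschitz l e g,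
        forall x, mdist (g (f x)) x <= e & forall y, mdist (f (g y)) y <= e].

Record ends_constants f C D l e r : Prop := EndsConstants {
  ends_l_ge1 : 1 <= l;
  ends_e_ge0 : 0 <= e;
  ends_r_ge0 : 0 <= r;
  ends_lower : forall x x', l^-1 * mdist x x' - e <= mdist (f x) (f x');
  ends_upper : coarse_lipschitz l e f;
  ends_nbhd : D `<=` open_nbhd_of (f @` C) r
}.

Section with_constants.
Context {f : X -> Y} {C : set X} {D : set Y} {l e r : R}.
Hypothesis h : ends_constants f C D l e r.

Let l_ge0 : 0 <= l.
Proof. exact: le_trans (ends_l_ge1 h). Qed.

Let l_gt0 : 0 < l.
Proof. exact: lt_le_trans (ends_l_ge1 h). Qed.

Lemma scale_index_ge0 (s : {nonneg R}) : 0 <= l * s%:num + e.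
Proof. by rewrite addr_ge0 ?(ends_e_ge0 h)// mulr_ge0. Qed.

Definition scale_index (s : {nonneg R}) : {nonneg R} :=
  NngNum (scale_index_ge0 s).

Lemma radius_index_ge0 (n : {nonneg R}) : 0 <= l * (n%:num + e + r).
Proof.
by rewrite mulr_ge0// !addr_ge0 ?(ends_e_ge0 h) ?(ends_r_ge0 h).
Qed.

(* The map on components goes from radius [m] to radius [m / l - e - r]. The
   latter ranges over all [n >= 0] as [m] ranges over [m >= l * (e + r)], and
   [radius_index] is [m] as a function of [n]. *)
Definition radius_index (n : {nonneg R}) : {nonneg R} :=
  NngNum (radius_index_ge0 n).

Lemma radius_indexE (n m : {nonneg R}) :
  n%:num = m%:num / l - e - r <-> m = radius_index n.
Proof.
split=> [nm|->] /=; last first.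
  by rewrite mulrAC divff ?gt_eqF// mul1r; lra.
have E : n%:num + e + r = m%:num / l by rewrite nm; lra.
by apply/val_inj; rewrite /= E mulrCA divff ?gt_eqF// mulr1.
Qed.

Lemma radius_index_mono (n n' : {nonneg R}) :
  nng_le n n' -> nng_le (radius_index n) (radius_index n').
Proof. by move=> nn'; rewrite /nng_le /= ler_wpM2l// !lerD2r. Qed.

Lemma coarse_map_radius (s n : {nonneg R}) :
  coarse_map f (~` open_nbhd_of C (radius_index n)%:num) s%:num
               (~` open_nbhd_of D n%:num) (scale_index s)%:num.
Proof.
split=> [x nx [d Dd xd]|x x' xx'|A [M hM]].
- have [_ [c Cc <-] dc] := ends_nbhd h Dd.
  apply: nx; exists c => //=.
  have := metric_triangle (f x) d (f c); move: (ends_lower h x c) => h1 h2.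
  rewrite -ltr_pdivrMl//.
  have := le_lt_trans (le_trans h1 h2) (ltrD xd dc).
  by rewrite ltrBlDr addrAC.
- by apply: le_trans (ends_upper h _ _) _; rewrite /= lerD2r ler_wpM2l.
- exists (l * (M + e)) => x y Ax Ay.
  rewrite -ler_pdivrMl// -lerBlDr.
  by apply: le_trans (ends_lower h _ _) _; apply: hM; [exists x|exists y].
Qed.

Definition ends_at_induced (s : {nonneg R}) :
    ends_at C s%:num -> ends_at D (scale_index s)%:num :=
  ends_at_map radius_index_mono (coarse_map_radius s).

Definition ends_induced (x : {s : {nonneg R} & ends_at C s%:num}) :
    {t : {nonneg R} & ends_at D t%:num} :=
  existT _ (scale_index (tag x)) (ends_at_induced (tagged x)).

Definition filtered_ends_map_of : filtered_ends C -> filtered_ends D :=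
  @dirlim_map _ _ _ (@ends_coarsen _ _ C) _ _ _ (@ends_coarsen _ _ D)
    ends_induced.

Lemma ends_at_induced_sub s (x : ends_at C s%:num) n :
  f @` sval (sval x (radius_index n)) `<=` sval (sval (ends_at_induced x) n).
Proof. exact: Cinf_map_sub. Qed.

Lemma scale_index_mono (s s' : {nonneg R}) :
  nng_le s s' -> nng_le (scale_index s) (scale_index s').
Proof. by move=> ss'; rewrite /nng_le /= lerD2r ler_wpM2l. Qed.

Lemma ends_at_induced_coarsen (s k K : {nonneg R}) (sk : nng_le s k)
    (sK : nng_le (scale_index s) K) (kK : nng_le (scale_index k) K)
    (x : ends_at C s%:num) :
  ends_coarsen sK (ends_at_induced x) =
  ends_coarsen kK (ends_at_induced (ends_coarsen sk x)).
Proof.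
apply: ends_at_eq => n.
have [[[a xa] _ _ _] _] := svalP (sval x (radius_index n)).
exists (f a); split; apply: ends_coarsen_sub; apply: ends_at_induced_sub;
  exists a => //; exact: ends_coarsen_sub.
Qed.

End with_constants.

Lemma ends_at_induced_rel f C D l e r l' e' r'
    (h : ends_constants f C D l e r) (h' : ends_constants f C D l' e' r')
    (x y : {s : {nonneg R} & ends_at C s%:num}) :
  dirlim_rel (@ends_coarsen _ _ C) x y ->
  dirlim_rel (@ends_coarsen _ _ D) (ends_induced h x) (ends_induced h' y).
Proof.
case: x y => [s x] [s' y] [k [/= sk [s'k xy]]].
have [K kK kK'] := nng_le_dir (scale_index h k) (scale_index h' k).
exists K, (nng_le_trans (scale_index_mono h sk) kK),
  (nng_le_trans (scale_index_mono h' s'k) kK') => /=.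
rewrite (ends_at_induced_coarsen sk _ kK) xy.
rewrite (ends_at_induced_coarsen s'k _ kK').
apply: ends_at_eq => n; set z := ends_coarsen s'k y.
have [N nN nN'] := nng_le_dir (radius_index h n) (radius_index h' n).
have [[[a za] _ _ _] _] := svalP (sval z N).
by exists (f a); split; apply: ends_coarsen_sub; apply: ends_at_induced_sub;
  exists a => //; apply: ends_at_sub za.
Qed.

Lemma filtered_ends_map_ofE f C D l e r l' e' r'
    (h : ends_constants f C D l e r) (h' : ends_constants f C D l' e' r')
    (x : {s : {nonneg R} & ends_at C s%:num}) :
  filtered_ends_map_of h (dirlim_class (@ends_coarsen _ _ C) x) =
  dirlim_class (@ends_coarsen _ _ D) (ends_induced h' x).
Proof.
apply/filtered_ends_classP/ends_at_induced_rel/filtered_ends_classP.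
exact: dirlim_reprK.
Qed.

Lemma filtered_ends_map_of_indep f C D l e r l' e' r'
    (h : ends_constants f C D l e r) (h' : ends_constants f C D l' e' r') :
  filtered_ends_map_of h = filtered_ends_map_of h'.
Proof.
apply/funext => P; rewrite -(dirlim_reprK P).
by rewrite (filtered_ends_map_ofE h h') (filtered_ends_map_ofE h' h').
Qed.

Lemma ends_constants_exist f C D :
  quasi_isometry f -> (hdist (f @` C) D < +oo)%E ->
  exists c : R * R * R, ends_constants f C D c.1.1 c.1.2 c.2.
Proof.
move=> [l [e [g [[l1 e0] lf lg gf fg]]]] /ereal_inf_lt[_ [r [r0 _ Dr] <-] _].
have l0 : 0 < l by exact: lt_le_trans l1.
exists (l, 3 * e, r); split=> //=.
- by rewrite mulr_ge0.
- move=> x x'.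
  have h1 := metric_triangle x (g (f x)) x'.
  have h2 := metric_triangle (g (f x)) (g (f x')) x'.
  have h3 := lg (f x) (f x').
  have h4 := gf x; rewrite metric_sym in h4; have h5 := gf x'.
  have h6 : mdist x x' <= l * mdist (f x) (f x') + 3 * e by lra.
  rewrite lerBlDr ler_pdivrMl// mulrDr; apply: le_trans h6 _.
  by rewrite lerD2l ler_peMl// mulr_ge0.
- by move=> x x'; apply: le_trans (lf x x') _; rewrite lerD2l ler_peMl// ler1n.
Qed.

(* The constants are chosen; [filtered_ends_map_of_indep] shows that the choice
   is immaterial. *)
Definition filtered_ends_map f C D (qf : quasi_isometry f)
    (fCD : (hdist (f @` C) D < +oo)%E) : filtered_ends C -> filtered_ends D :=
  filtered_ends_map_of (svalP (cid (ends_constants_exist qf fCD))).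

Lemma filtered_ends_mapE f C D (qf : quasi_isometry f)
    (fCD : (hdist (f @` C) D < +oo)%E) l e r
    (h : ends_constants f C D l e r) :
  filtered_ends_map qf fCD = filtered_ends_map_of h.
Proof. exact: filtered_ends_map_of_indep. Qed.

End induced_map.

(* Main.v *)
(** A quasi-inverse [g] of [f] is again a quasi-isometry with [g(D)] at finite
    Hausdorff distance from [C], so it induces a map E(Y,D) -> E(X,C). Since
    [g \o f] moves points by at most some [e], a point of a component and its
    image under [g \o f] lie in the same component as soon as the scale is at
    least [e]; hence the two induced maps are inverse in the direct limit over
    the scale. *)

Require Import Defs.
From mathcomp Require Import all_boot all_order all_algebra.
From mathcomp Require Import all_classical all_reals.
From mathcomp Require Import ereal topology.
From mathcomp Require Import lra.

Import Order.TTheory GRing.Theory Num.Theory.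

Local Open Scope classical_set_scope.
Local Open Scope ring_scope.

(** A component is the chain class of any of its points, and [[:: y]] is a one-step chain from
    [x]. *)
Lemma Cinf_closed {R : realType} {X : metricType R} (Z : set X) (s : R)
    (B : Cinf Z s) x y :
  sval B x -> Z y -> mdist x y <= s -> sval B y.
Proof.
case: B => B [cB nB] /= Bx Zy xy; have [_ BZ _ _] := cB.
rewrite (coarse_componentE cB Bx); exists [:: y]; split=> //=.
  by rewrite xy.
by move=> z; rewrite !inE => /orP[/eqP ->|/eqP -> //]; exact: BZ.
Qed.

Lemma hdist_fin {R : realType} {X : metricType R} (A B : set X) (r : R) :
  0 <= r -> A `<=` open_nbhd_of B r -> B `<=` open_nbhd_of A r ->
  (hdist A B < +oo)%E.
Proof.
by move=> r0 AB BA; apply: (@le_lt_trans _ _ r%:E); [apply: ereal_inf_lbound;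
  exists r | exact: ltry].
Qed.

Lemma quasi_inverse_hdist {R : realType} {X Y : metricType R} {f : X -> Y}
    {g : Y -> X} {C : set X} {D : set Y} {l e : R} :
  1 <= l -> 0 <= e -> coarse_lipschitz l e g ->
  (forall x, mdist (g (f x)) x <= e) ->
  (hdist (f @` C) D < +oo)%E -> (hdist (g @` D) C < +oo)%E.
Proof.
move=> l1 e0 lg gf /ereal_inf_lt[_ [r [r0 CD DC] <-] _].
have l0 : 0 < l by exact: lt_le_trans l1.
(* One [e] comes from [lg], the other from [gf]; the [+ 1] turns the non-strict estimates into the
   strict one of open neighborhoods. *)
have near_g d c : mdist d (f c) < r -> mdist (g d) c < l * r + 2 * e + 1.
  move=> dc; have t1 := metric_triangle (g d) (g (f c)) c.
  have t2 := lg d (f c); have t3 := gf c.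
  have t4 : l * mdist d (f c) <= l * r by rewrite ler_wpM2l // ltW.
  by lra.
apply: (@hdist_fin _ _ _ _ (l * r + 2 * e + 1)).
- by rewrite !addr_ge0 ?mulr_ge0 // ltW.
- move=> _ [d Dd <-]; have [_ [c Cc <-] dc] := DC _ Dd.
  by exists c => //; exact: near_g.
- move=> c Cc; have [|d Dd cd] := CD (f c); first by exists c.
  exists (g d); first by exists d.
  by rewrite metric_sym; apply: near_g; rewrite metric_sym.
Qed.

(** Only [g \o f] is controlled, so exchanging [f] and [g] gives the other cancellation. *)
Lemma filtered_ends_map_ofK {R : realType} {X Y : metricType R} {f : X -> Y}
    {g : Y -> X} {C : set X} {D : set Y} {l e r l' e' r' b : R}
    (hf : ends_constants f C D l e r) (hg : ends_constants g D C l' e' r') :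
  0 <= b -> (forall x, mdist (g (f x)) x <= b) ->
  cancel (filtered_ends_map_of hf) (filtered_ends_map_of hg).
Proof.
move=> b0 gf P; rewrite -(dirlim_reprK P); case: (dirlim_repr P) => s x.
rewrite (filtered_ends_map_ofE hf hf) (filtered_ends_map_ofE hg hg).
apply/filtered_ends_classP.
have [K0 sK0 tK0] := nng_le_dir s (scale_index hg (scale_index hf s)).
(* Scale [K] allows the jump from [a] to [g (f a)]. *)
have [K K0K bK] := nng_le_dir K0 (NngNum b0).
exists K, (nng_le_trans tK0 K0K), (nng_le_trans sK0 K0K) => /=.
apply: ends_at_eq => n.
(* A point of [x] at radius [N] serves both for [x] at radius [n] and for its image under the two
   induced maps. *)
have [N nN mN] := nng_le_dir n (radius_index hf (radius_index hg n)).
have [[[a xa] _ _ _] _] := svalP (sval x N).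
set z := ends_coarsen _ _; set z' := ends_coarsen _ x.
have zgfa : sval (sval z n) (g (f a)).
  apply: ends_coarsen_sub; apply: ends_at_induced_sub; exists (f a) => //.
  by apply: ends_at_induced_sub; exists a => //; exact: ends_at_sub mN _ xa.
(* The point [a] itself need not lie in [z]; [g (f a)] does, hence avoids the neighborhood of [C],
   and is one jump away from [a] in [z']. *)
exists (g (f a)); split=> //.
apply: (@Cinf_closed _ _ _ _ _ a).
- by apply: ends_coarsen_sub; exact: ends_at_sub nN _ xa.
- by have [[_ sub _ _] _] := svalP (sval z n); exact: sub zgfa.
- by rewrite metric_sym; apply: le_trans (gf a) bK.
Qed.

Theorem theorem1p3 (R : realType) (X Y : metricType R) (C : set X) (D : set Y)
    (C0 : C !=set0) (D0 : D !=set0) (f : X -> Y) (qf : quasi_isometry f)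
    (fCD : (hdist (f @` C) D < +oo)%E) :
  bijective (filtered_ends_map qf fCD).
Proof.
have [l [e [g [[l1 e0] lf lg gf fg]]]] := qf.
have qg : quasi_isometry g by exists l, e, f; split.
have gDC := quasi_inverse_hdist l1 e0 lg gf fCD.
by exists (filtered_ends_map qg gDC); exact: (filtered_ends_map_ofK _ _ e0).
Qed.
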